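(* Let $G$ be a finite group such that for every conjugacy class $K$ of $G$ the set $K^2$ is a union of conjugacy classes of $G$ all of which are central except at most one. Let $M$ be the subgroup of $G$ containing $\mathbf{F}(G)$ such that $M/\mathbf{F}(G)=\mathbf{O}_2(G/\mathbf{F}(G))$. Then $G/M$ is nilpotent and, consequently, $G$ is solvable with Fitting length at most $3$.
   Context: For a subset $K\subseteq G$, $K^2=\{ab : a,b\in K\}$. A conjugacy class of $G$ is central if it is contained in the center $\mathbf{Z}(G)$ (equivalently, it has exactly one element). $\mathbf{F}(G)$ is the Fitting subgroup of $G$ (the largest nilpotent normal subgroup), and $\mathbf{O}_2(H)$ is the largest normal $2$-subgroup of a finite group $H$. The Fitting length of a finite solvable group is the smallest length $n$ of a normal series $1=N_0\le N_1\le\cdots\le N_n=G$ with nilpotent factors $N_{i}/N_{i-1}$. *)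

(* Defs.v *)
From mathcomp Require Import all_boot all_fingroup all_solvable.

Set Implicit Arguments.
Unset Strict Implicit.
Unset Printing Implicit Defensive.

Local Open Scope group_scope.

Section Defs.

Variable gT : finGroupType.
Implicit Types (G : {group gT}) (A : {set gT}).

Definition union_of_classes_all_but_one_central G A : Prop :=
  exists P : {set {set gT}},
    [/\ P \subset classes G,
        A = cover P
      & #|[set L in P | ~~ (L \subset 'Z(G))]| <= 1].

(* As for chief_factor, the ambient group comes first, then the lower group V
   and the upper group U. *)
Definition nilpotent_factor A (V U : {set gT}) :=
  [&& V \subset U, U <| A & nilpotent (U / V)].

(* s lists N_1, ..., N_n; the initial term N_0 = 1 is implicit, so that the
   length n of the series is the size of s. *)
Definition nilpotent_normal_series G (s : seq {group gT}) :=
  (nilpotent_factor G).-series 1%G s && (last 1%G s == G).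

Definition has_nilpotent_normal_series G n :=
  [exists s : n.-tuple {group gT}, nilpotent_normal_series G s].

Lemma solvable_has_nilpotent_normal_series G :
  solvable G -> exists n, has_nilpotent_normal_series G n.
Proof.
case/derivedP=> n Gn1; exists n; apply/existsP.
have [s]: exists2 s : n.-tuple {group gT},
    (nilpotent_factor G).-series (G^`(n))%G s & last (G^`(n))%G s == G.
  elim: n {Gn1} => [|n [s ser_s last_s]].
    by exists [tuple] => //=; apply/eqP/val_inj.
  exists [tuple of (G^`(n))%G :: s] => //=; rewrite ser_s andbT.
  by rewrite /nilpotent_factor der_subS der_normal abelian_nil ?der_abelian.
have -> : (G^`(n))%G = 1%G by apply: val_inj.
by exists s; apply/andP.
Qed.

Definition fitting_length G (solG : solvable G) : nat :=
  ex_minn (solvable_has_nilpotent_normal_series solG).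

End Defs.

(* Main.v *)
Require Import Defs.
From mathcomp Require Import all_boot all_fingroup all_solvable.

(** Write K for the class of x. The hypothesis says that any two noncentral
elements of K * K are conjugate in G, a condition that passes to quotients, and
everything follows from comparing x * x with other products in K * K.

If G has trivial center, then the elements of a minimal normal subgroup N are
real ([minnormal_real]): otherwise 1 is not in K * K, so K * K is the class of
x * x and has at most #|K| elements; hence K * K = K :* y for every y in K, the
right stabiliser of K is normalised by G and meets N nontrivially, so it
contains N, and then 1 lies in K, which forces x = 1.

Solvability amounts to 'F(G) != 1 when G != 1 ([Fitting_neq1]). With a trivial
center, real elements force an involution t. If t lies outside 'O_2(G), the
Baer-Suzuki theorem gives a conjugate whose product with t does not have
2-power order; a power e of this product has odd prime order p, and both e and
e * e lie in the square of the class of t, hence are conjugate. So every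
nontrivial product of two conjugates of e is conjugate to e, and these
conjugates together with 1 form a normal p-subgroup.

For the nilpotency of G / M, a quotient G / N with 'F(G) \subset N and
'O_2(G / N) = 1 is shown to be nilpotent ([nilpotent_quotient_trivg_pcore2]).
Dividing by centers keeps 'O_2 trivial, so it is enough to exclude a nontrivial
G / N with trivial center. In such a quotient a minimal normal subgroup W / N
is abelian of odd exponent and consists of real elements. For x in W outside N,
K * K then meets N but contains x * x, which is noncentral and outside N; so
K * K meets N in central elements only, which yields [~: W, N] \subset 'Z(G)
([commutators_central]). Thus W is nilpotent, W \subset 'F(G) \subset N, a
contradiction. *)

Set Implicit Arguments.
Unset Strict Implicit.
Unset Printing Implicit Defensive.

Local Open Scope group_scope.

(** * Fusion of noncentral products *)

(** An elementwise form of the condition that the square of each class has at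
most one noncentral class, convenient for passing to quotients. *)
Definition noncentral_squares_fuse (gT : finGroupType) (G : {group gT}) :=
  forall x a b : gT, x \in G ->
    a \in x ^: G * x ^: G -> b \in x ^: G * x ^: G ->
    a \notin 'Z(G) -> b \notin 'Z(G) -> b \in a ^: G.

Lemma square_union_fuse (gT : finGroupType) (G : {group gT}) :
  (forall K : {set gT}, K \in classes G ->
     union_of_classes_all_but_one_central G (K * K)) ->
  noncentral_squares_fuse G.
Proof.
move=> sqG x a b Gx.
have [P [sP -> leP1]] := sqG _ (mem_classes Gx).
case/bigcupP=> A PA Aa /bigcupP[B PB Bb] nZa nZb.
have nZ (L : {set gT}) c : c \in L -> c \notin 'Z(G) -> ~~ (L \subset 'Z(G)).
  by move=> Lc; apply: contra => /subsetP->.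
have eqAB : A = B.
  apply: (card_le1_eqP leP1); rewrite inE ?PA ?PB /=.
  - exact: (nZ _ b).
  exact: (nZ _ a).
have /imsetP[y Gy defA] := subsetP sP _ PA.
by move: Aa Bb; rewrite -eqAB defA => /class_eqP->.
Qed.

Lemma mulJ_class (gT : finGroupType) (G : {group gT}) (x g : gT) :
  g \in G -> x * x ^ g \in x ^: G * x ^: G.
Proof. by move=> Gg; rewrite mem_mulg ?class_refl ?memJ_class. Qed.

(** Noncentral elements of the square of a class of [G / N] lift to noncentral
elements of the square of a class of [G]. *)
Lemma fuse_quotient (gT : finGroupType) (G N : {group gT}) :
  N <| G -> noncentral_squares_fuse G -> noncentral_squares_fuse (G / N).
Proof.
move=> nsNG fuseG xb ab bb /morphimP[x Nx Gx ->] {xb}.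
have nNG := normal_norm nsNG.
have lift cb : cb \in coset N x ^: (G / N) * coset N x ^: (G / N) ->
    cb \notin 'Z(G / N) ->
  exists c, [/\ c \in G, c \in x ^: G * x ^: G, c \notin 'Z(G)
              & cb = coset N c].
- have nKN : x ^: G \subset 'N(N) by rewrite (subset_trans _ nNG) ?class_subG.
  rewrite -quotient_class // -quotientMl //.
  case/morphimP=> c Nc Kc -> nZ.
  have Gc : c \in G.
    by apply: subsetP Kc; rewrite mul_subG ?class_subG.
  exists c; split=> //; apply: contra nZ => Zc.
  by apply: (subsetP (morphim_center _ _)); apply: mem_quotient.
move=> Ka Kb /(lift _ Ka)[a [Ga {}Ka nZa ->]] /(lift _ Kb)[b [Gb {}Kb nZb ->]].
have Na := subsetP nNG _ Ga.
by rewrite -quotient_class // mem_morphim ?(subsetP nNG) //; apply: (fuseG x).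
Qed.

(** * Groups with trivial center, and solvability *)

(** An element inverting x acts on it as an involution, so its odd powers
invert x as well; in a group of odd order one of them is 1. *)
Lemma real_even (gT : finGroupType) (G : {group gT}) (x h : gT) :
  x \in G -> h \in G -> x != 1 -> x ^ h = x^-1 -> 2 %| #|G|.
Proof.
move=> Gx Gh ntx xh; apply: contraT; rewrite dvdn2 negbK => oddG.
have xhn n : x ^ (h ^+ n) = if odd n then x^-1 else x.
  elim: n => [|n IHn] /=; first by rewrite conjg1.
  by rewrite expgSr conjgM IHn; case: odd; rewrite //= conjVg xh invgK.
have := xhn #|G|; rewrite oddG expg_cardG // conjg1 => xV.
have: #[x] %| 2 by rewrite order_dvdn expgS expg1 {2}xV mulgV.
have co2 : coprime #[x] 2.
  by rewrite coprime_sym (coprime_dvdr (order_dvdG Gx)) // coprime2n.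
by rewrite -{1}(muln1 2) Gauss_dvdr // dvdn1 order_eq1 (negPf ntx).
Qed.

(** The conjugates of e together with 1 are closed under products; all their
nontrivial elements have order p, so they form a normal p-subgroup. *)
Lemma square_closed_class_Fitting (gT : finGroupType) (G : {group gT})
    (e : gT) (p : nat) :
  e \in G ->
  (forall y, y \in e ^: G * e ^: G -> y != 1 -> y \in e ^: G) ->
  prime p -> #[e] = p -> e \in 'F(G).
Proof.
move=> Ge closed pr_p oe; set D := e ^: G in closed.
have gD : group_set (1 |: D).
  apply/group_setP; split=> [|y z]; first exact: setU11.
  case/setU1P=> [-> | Dy]; first by rewrite mul1g.
  case/setU1P=> [-> | Dz]; first by rewrite mulg1 setU1r.
  have [-> | ntyz] := eqVneq (y * z) 1; first exact: setU11.
  by rewrite setU1r // closed ?mem_mulg.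
have pD : p.-group (group gD).
  apply/pgroupP=> q pr_q /Cauchy[] // y /setU1P[-> | /imsetP[g Gg ->]] oy.
    by rewrite order1 in oy; rewrite -oy in pr_q.
  by rewrite orderJ oe in oy; rewrite -oy inE.
have nDG : group gD <| G.
  apply/andP; split; first by rewrite subUset sub1G class_subG.
  by rewrite normsU ?norms1 // class_norm.
apply: (subsetP (Fitting_max nDG (pgroup_nil pD))).
by rewrite /= setU1r // class_refl.
Qed.

Section CenterFree.

Variables (gT : finGroupType) (G : {group gT}).
Hypotheses (fuseG : noncentral_squares_fuse G) (Z1 : 'Z(G) = 1).

(** If K * K did not contain 1, it would be a translate of the class K, so the
right stabiliser of K would be large enough to contain N. *)
Lemma minnormal_real (N : {group gT}) (x : gT) :
  minnormal N G -> N \subset G -> x \in N -> x^-1 \in x ^: G.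
Proof.
case/mingroupP=> /andP[ntN nNG] minN sNG Nx.
have Gx := subsetP sNG x Nx.
have [-> | ntx] := eqVneq x 1; first by rewrite invg1 class_refl.
apply: contraT => nKx'; set K := x ^: G in nKx'.
have nK1 : 1 \notin K * K.
  apply: contra nKx' => /mulsgP[_ z /imsetP[g Gg ->] Kz eq1].
  have -> : x^-1 = z ^ g^-1.
    have -> : z = (x ^ g)^-1 by apply/eqP; rewrite eq_sym eq_invg_mul -eq1.
    by rewrite -conjVg -conjgM mulgV conjg1.
  by rewrite memJ_norm // (subsetP (class_norm x G)) ?groupV.
have Kxx : K * K \subset (x * x) ^: G.
  apply/subsetP=> b Kb; apply: (fuseG Gx) => //.
  - by rewrite mem_mulg ?class_refl.
  - rewrite Z1 inE; apply: contraNneq nK1 => <-.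
    by rewrite mem_mulg ?class_refl.
  by rewrite Z1 inE; apply: contraNneq nK1 => <-.
(* Squaring maps K onto the class of x * x. *)
have leKK : #|K * K| <= #|K|.
  apply: leq_trans (subset_leq_card Kxx) _.
  apply: leq_trans (leq_imset_card (fun y => y * y) _).
  apply/subset_leq_card/subsetP=> _ /imsetP[g Gg ->].
  by rewrite conjMg; apply/imsetP; exists (x ^ g); rewrite ?memJ_class.
have KKr y : y \in K -> K :* y = K * K.
  move=> Ky; apply/eqP.
  by rewrite eqEcard mulgS ?sub1set //= card_rcoset.
have memS y : y \in 'N(K | 'R) -> K :* y = K.
  move=> Sy; apply/eqP; rewrite eqEcard card_rcoset leqnn andbT.
  apply/subsetP=> _ /rcosetP[z Kz ->].
  by have := astabs_act z Sy; rewrite /= Kz.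
have mem1S y : K :* y = K -> y \in 'N(K | 'R).
  move=> Ky; rewrite !inE; apply/subsetP=> z.
  by rewrite inE /= -{2}Ky mem_rcoset mulgK.
have nSG : G \subset 'N('N(K | 'R)).
  apply/subsetP=> g Gg; rewrite inE; apply/subsetP=> _ /imsetP[y /memS Ky ->].
  apply: mem1S.
  have Kg : K :^ g = K by apply/normP/(subsetP (class_norm x G)).
  by rewrite -{1}Kg -conjg_set1 -conjsMg Ky.
(* The stabiliser meets N nontrivially: it contains x ^ g * x^-1 for all g. *)
have [g Gg ngx] : exists2 g, g \in G & x ^ g != x.
  apply/exists_inP; apply: contraR ntx; rewrite negb_exists_in => /forall_inP cxG.
  suff : x \in 'Z(G) by rewrite Z1 inE.
  rewrite inE Gx; apply/centP=> g Gg; apply/commgP/conjg_fixP/eqP.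
  by have := cxG g Gg; rewrite negbK.
have Nxg : x ^ g * x^-1 \in N.
  by rewrite groupMr ?groupV // memJ_norm // (subsetP nNG).
have Sxg : x ^ g * x^-1 \in 'N(K | 'R).
  apply: mem1S; rewrite rcosetM (KKr (x ^ g)) ?memJ_class //.
  by rewrite -(KKr x) ?class_refl // rcosetK.
have sNS : N \subset 'N(K | 'R).
  rewrite -(minN (N :&: 'N(K | 'R))%G) ?subsetIl ?subsetIr //=.
  rewrite normsI // andbT; apply/trivgPn; exists (x ^ g * x^-1); first exact/setIP.
  by rewrite -eq_mulgV1.
have Kx' : K :* x^-1 = K by apply: memS; rewrite groupV (subsetP sNS).
have : 1 \in K by rewrite -Kx' mem_rcoset invgK mul1g class_refl.
by rewrite class_sym class1G inE (negPf ntx).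
Qed.

(** A product d of two conjugate involutions, not of 2-power order, has its even
powers in the square of their class; one of them has odd prime order. *)
Lemma center_free_Fitting_neq1 : G :!=: 1 -> 'F(G) != 1.
Proof.
move=> ntG.
have [N minN sNG] := minnormal_exists ntG (normG G).
have [x Nx ntx] : exists2 x, x \in N & x != 1.
  by apply/trivgPn; case/mingroupP: minN => /andP[].
have Gx := subsetP sNG x Nx.
have /imsetP[h Gh /esym xh] := minnormal_real minN sNG Nx.
have [//|t Gt ot] := Cauchy _ (real_even Gx Gh ntx xh).
have t2 : t * t = 1 by rewrite -(expg_order t) ot.
have tV : t^-1 = t by apply/eqP; rewrite eq_invg_mul t2.
have [O2t | nO2t] := boolP (t \in 'O_2(G)).
  apply/trivgPn; exists t; last by rewrite -order_eq1 ot.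
  have nilO2 : nilpotent 'O_2(G) := pgroup_nil (pcore_pgroup 2 G).
  exact: (subsetP (Fitting_max (pcore_normal _ _) nilO2)).
have [g Gg] : exists2 g, g \in G & ~~ 2.-group <<[set t; t ^ g]>>.
  apply/exists_inP; apply: contraR nO2t; rewrite negb_exists_in => /forall_inP tG2.
  by apply: (Baer_Suzuki Gt) => y Gy; have := tG2 y Gy; rewrite negbK.
set d := t * t ^ g => not2.
have Gd : d \in G by rewrite groupM ?groupJ.
have dt : d ^ t = d^-1.
  by rewrite conjgE -mulgA mulKg invMg -conjVg tV.
have not2d : ~~ 2.-elt d.
  apply: contra not2 => d2.
  have nd : <[t]> \subset 'N(<[d]>).
    by rewrite cycle_subG; apply/normP; rewrite -cycleJ dt cycleV.
  apply: (@pgroupS _ 2 (<[d]> <*> <[t]>)).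
    rewrite gen_subG subUset !sub1set mem_gen ?inE ?cycle_id ?orbT //=.
    have -> : t ^ g = t * d by rewrite /d mulgA t2 mul1g.
    by rewrite groupM ?mem_gen ?inE ?cycle_id ?orbT.
  rewrite /= norm_joinEr // pgroupM; apply/andP; split=> //.
  by rewrite /pgroup -orderE ot.
have [p] : exists2 p, prime p & (p %| #[d]) && (p != 2).
  move: not2d; rewrite /p_elt /pnat order_gt0 /= => /allPn[p].
  rewrite mem_primes !inE => /and3P[pr_p _ p_d] np2; exists p => //.
  by rewrite p_d.
move=> pr_p /andP[p_d np2].
(* The exponent is doubled because only even powers of d are visibly products
   of t with a conjugate; as p is odd, doubling does not change the order. *)
pose m := #[d] %/ p; pose e := d ^+ m.*2.
have sq n : d ^+ n.*2 \in t ^: G * t ^: G.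
  have dnt : (d ^+ n) ^ t = d ^- n by rewrite conjXg dt expgVn.
  have -> : d ^+ n.*2 = t * t ^ (d ^+ n).
    have -> : t ^ (d ^+ n) = t * d ^+ n.*2.
      rewrite conjgE -dnt conjgE tV -addnn expgD.
      by rewrite -!mulgA (mulgA t t) t2 mul1g.
    by rewrite mulgA t2 mul1g.
  by rewrite mulJ_class ?groupX.
have om : #[d ^+ m] = p.
  by rewrite orderXdiv ?dvdn_div // /m divnA // mulKn.
have oe : #[e] = p.
  rewrite /e -muln2 expgM orderXgcd om (eqP (_ : coprime p 2)) ?divn1 //.
  by rewrite prime_coprime // dvdn_prime2.
have nte : e != 1 by rewrite -order_eq1 oe neq_ltn prime_gt1 ?orbT.
have Ge : e \in G by rewrite groupX.
have nt_conj y : y \in t ^: G * t ^: G -> y != 1 -> y \in e ^: G.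
  move=> Ky nty; apply: (fuseG Gt) => //; first exact: sq.
    by rewrite Z1 inE.
  by rewrite Z1 inE.
have nte2 : e * e != 1.
  apply: contraNneq np2 => e21.
  by rewrite -dvdn_prime2 // -oe order_dvdn expgS expg1 e21.
have e2 : e * e \in e ^: G.
  by apply: nt_conj => //; rewrite -expgD addnn; apply: sq.
apply/trivgPn; exists e => //.
(* Noncentral products of conjugates of e are conjugate to e * e, so to e. *)
apply: (square_closed_class_Fitting Ge _ pr_p oe) => y Ky nty.
rewrite -(class_eqP e2); apply: (fuseG Ge) => //.
- by rewrite mem_mulg ?class_refl.
- by rewrite Z1 inE.
by rewrite Z1 inE.
Qed.

End CenterFree.

Lemma Fitting_neq1 (gT : finGroupType) (G : {group gT}) :
  noncentral_squares_fuse G -> G :!=: 1 -> 'F(G) != 1.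
Proof.
move=> fuseG ntG; have [Z1 | ntZ] := eqVneq 'Z(G) 1.
  exact: center_free_Fitting_neq1.
apply: contraNneq ntZ => F1; rewrite -subG1 -F1.
by rewrite Fitting_max ?center_normal // abelian_nil ?center_abelian.
Qed.

Lemma fuse_solvable (gT : finGroupType) (G : {group gT}) :
  noncentral_squares_fuse G -> solvable G.
Proof.
have [n] := ubnP #|G|; elim: n gT G => // n IHn gT G leGn fuseG.
have [-> | ntG] := eqVneq (G : {set gT}) 1; first exact: solvable1.
rewrite (series_sol (Fitting_normal G)) nilpotent_sol ?Fitting_nil //=.
apply: IHn; last exact: fuse_quotient (Fitting_normal G) fuseG.
rewrite -ltnS (leq_trans _ leGn) // ltnS.
by rewrite ltn_quotient ?Fitting_neq1 ?Fitting_sub.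
Qed.

(** * Nilpotent quotients *)

Lemma central_extension_nil (gT : finGroupType) (G Z : {group gT}) :
  Z \subset 'Z(G) -> nilpotent (G / Z) -> nilpotent G.
Proof.
move=> sZ nilGZ; have cZG : Z \subset 'C(G) := subset_trans sZ (subsetIr _ _).
have nZG : G \subset 'N(Z) by rewrite cents_norm // centsC.
apply/forall_inP=> H /subsetIP[sHG sHHG].
have sHZ : H \subset Z.
  rewrite -quotient_sub1 ?(subset_trans sHG) //.
  apply/trivgP/eqP/(forall_inP nilGZ (H / Z)%G).
  by rewrite subsetI /= quotientS // -quotientR ?quotientS // (subset_trans sHG).
rewrite -subG1 (subset_trans sHHG) // (commG1P _) //.
exact: subset_trans cZG.
Qed.

(** The preimage of 'O_p(G / 'Z(G)) is a central extension of a p-group, hence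
nilpotent; its p-core lies in that of G, so it is a p'-group. *)
Lemma trivg_pcore_mod_center (gT : finGroupType) (G : {group gT}) (p : nat) :
  'O_p(G) = 1 -> 'O_p(G / 'Z(G)) = 1.
Proof.
move=> Op1.
have [P defP sZP nsPG] :=
  inv_quotientN (center_normal G) (pcore_normal p (G / 'Z(G))).
have pPZ : p.-group (P / 'Z(G)) by rewrite -defP pcore_pgroup.
have nilP : nilpotent P.
  apply: central_extension_nil (pgroup_nil pPZ).
  by rewrite subsetI sZP (subset_trans _ (centS (normal_sub nsPG))) ?subsetIr //.
have Op1P : 'O_p(P) = 1.
  apply/trivgP; rewrite -Op1 pcore_max ?pcore_pgroup //.
  exact: gFnormal_trans.
have p'P : p^'.-group P.
  have := nilpotent_pcore_Hall p nilP; rewrite Op1P.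
  by case/and3P=> _ _; rewrite indexg1.
rewrite defP; apply/card1_trivg/(pnat_1 pPZ).
exact: quotient_pgroup.
Qed.

(** A noncentral element of N in the square of the class of x would be conjugate
to the noncentral x * x, which is not in N. So z := x * x ^ g is central, hence
x ^ g = x^-1 * z, and [z * [~ x, n] = x ^ g * x ^ n] is again an element of N in
that square. *)
Lemma commutators_central (gT : finGroupType) (G N : {group gT}) (x g : gT) :
  noncentral_squares_fuse G -> N <| G -> 'Z(G) \subset N ->
  x \in G -> g \in G -> x * x \notin N -> x * x ^ g \in N ->
  forall n, n \in N -> [~ x, n] \in 'Z(G).
Proof.
move=> fuseG /andP[sNG nNG] sZN Gx Gg nNxx Nxxg n Nn.
have central y : y \in x ^: G * x ^: G -> y \in N -> y \in 'Z(G).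
  move=> Ky Ny; apply: contraR (nNxx) => nZy.
  have /imsetP[h Gh ->] : x * x \in y ^: G.
    apply: (fuseG x) => //; first by rewrite mem_mulg ?class_refl.
    by apply: contra nNxx; apply: (subsetP sZN).
  by rewrite memJ_norm // (subsetP nNG).
have Zz := central _ (mulJ_class x Gg) Nxxg.
rewrite -(groupMl _ Zz); apply: central.
  have -> : x * x ^ g * [~ x, n] = x ^ g * x ^ n.
    have Cz : x * x ^ g \in 'C(G) by case/setIP: Zz.
    have /centP/(_ x^-1 (groupVr Gx)) cxz := Cz.
    by rewrite commgEl mulgA cxz mulKg.
  by rewrite mem_mulg ?memJ_class // (subsetP sNG).
by rewrite groupMl // commgEr groupM // memJ_norm ?groupV // (subsetP nNG) //.
Qed.

(** Induction on the index of N: a nontrivial center of [G / N] is factored out,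
and a trivial one leads to a nilpotent normal subgroup strictly above N. *)
Lemma nilpotent_quotient_trivg_pcore2 (gT : finGroupType) (G N : {group gT}) :
  noncentral_squares_fuse G -> N <| G -> 'F(G) \subset N ->
  'O_2(G / N) = 1 -> nilpotent (G / N).
Proof.
move=> fuseG; have [n] := ubnP #|G / N|.
elim: n N => // n IHn N leGNn nsNG sFN O2; have [sNG nNG] := andP nsNG.
have [GN1 | ntGN] := eqVneq (G / N) 1; first by rewrite GN1 nilpotent1.
have [Z1 | ntZ] := eqVneq 'Z(G / N) 1; last first.
  have [N2 defN2 sNN2 nsN2G] := inv_quotientN nsNG (center_normal (G / N)).
  have iso3 := third_isog sNN2 nsNG nsN2G.
  rewrite -quotient_center_nil /= defN2 (isog_nil iso3); apply: IHn => //.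
  - rewrite -(card_isog iso3) -defN2 -ltnS (leq_trans _ leGNn) // ltnS.
    by rewrite ltn_quotient // center_sub.
  - exact: subset_trans sNN2.
  apply/eqP; rewrite -(isog_eq1 (isog_pcore 2 iso3)) /= -defN2.
  exact/eqP/trivg_pcore_mod_center.
have [Wb minW sWG] := minnormal_exists ntGN (normG (G / N)).
have solGN : solvable (G / N) by rewrite quotient_sol ?fuse_solvable.
have [nWG ntW /is_abelemP[p pr_p abW]] := minnormal_solvable minW sWG solGN.
have nsWG : Wb <| G / N by apply/andP.
have [W defW sNW nsW] := inv_quotientN nsNG nsWG.
rewrite defW in minW sWG nWG ntW abW nsWG.
have sWG' := normal_sub nsW.
have nNW := subset_trans sWG' nNG.
have p2 : p != 2.
  apply: contraNneq ntW => p2; rewrite -subG1 -O2 pcore_max // -p2.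
  exact: abelem_pgroup abW.
have sZN : 'Z(G) \subset N.
  apply: subset_trans sFN.
  by rewrite Fitting_max ?center_normal ?abelian_nil ?center_abelian.
have central x y : x \in W :\: N -> y \in N -> [~ x, y] \in 'Z(G).
  case/setDP=> Wx nNx Ny.
  have Gx := subsetP sWG' x Wx; have nx := subsetP nNG x Gx.
  have Wbx : coset N x \in W / N := mem_quotient N Wx.
  have ntx : coset N x != 1 by apply: contra nNx => /eqP/coset_idr->.
  have := minnormal_real (fuse_quotient nsNG fuseG) Z1 minW sWG Wbx.
  rewrite -quotient_class // => /morphimP[z nz /imsetP[g Gg ->] xz].
  apply: (commutators_central fuseG nsNG sZN Gx Gg) => //.
    apply: contra p2 => Nxx.
    rewrite -dvdn_prime2 // -(abelem_order_p abW Wbx ntx) order_dvdn.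
    by rewrite -morphX //= expgS expg1 coset_id.
  have nxg : x ^ g \in 'N(N) by rewrite (subsetP nNG) ?groupJ.
  apply: coset_idr; first exact: groupM.
  by rewrite morphM //= -xz mulgV.
(* Elements of W outside N generate W: for x in N, write x = (x * w) * w^-1. *)
have sNWZ : [~: W, N] \subset 'Z(G).
  have /trivgPn[_ /morphimP[w nw Ww ->] ntw] := ntW.
  have nNw : w \notin N by apply: contra ntw => Nw; rewrite /= coset_id.
  have nZG := normal_norm (center_normal G).
  rewrite gen_subG; apply/subsetP=> _ /imset2P[x y Wx Ny ->].
  have [Nx | nNx] := boolP (x \in N); last by apply: central; rewrite ?inE ?nNx.
  rewrite -(mulgK w x) commMgJ.
  rewrite groupM ?memJ_norm ?(subsetP nZG) ?groupV ?(subsetP sWG') //.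
    by apply: central; rewrite // inE groupMl // nNw groupM // (subsetP sNW).
  by apply: central; rewrite // inE !groupV nNw.
(* The series 1, 'Z(G) :&: W, N, W: if H is contained in [~: H, W], then H lies
   successively in N, in 'Z(G) and in 1. *)
have nilW : nilpotent W.
  apply/forall_inP=> H /subsetIP[sHW sHHW].
  have sHN : H \subset N.
    rewrite (subset_trans (subset_trans sHHW (commSg _ sHW))) //.
    by rewrite -quotient_cents2 //; exact: abelem_abelian abW.
  have sHZ : H \subset 'Z(G).
    by rewrite (subset_trans sHHW) // (subset_trans _ sNWZ) // commGC commgS.
  rewrite -subG1 (subset_trans sHHW) // (commG1P _) //.
  by rewrite (subset_trans sHZ) // subIset // centS ?orbT.
case/negP: ntW; rewrite -subG1 quotient_sub1 // (subset_trans _ sFN) //.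
by rewrite Fitting_max.
Qed.

Theorem corollaryF (gT : finGroupType) (G M : {group gT})
    (sqG : forall K : {set gT}, K \in classes G ->
       union_of_classes_all_but_one_central G (K * K))
    (sMG : M \subset G)
    (sFM : 'F(G) \subset M)
    (defM : M / 'F(G) = 'O_2(G / 'F(G))) :
  nilpotent (G / M) /\
  exists solG : solvable G, fitting_length solG <= 3.
Proof.
have fuseG := square_union_fuse sqG.
have nsFG := Fitting_normal G.
have nsMG : M <| G.
  rewrite -(quotientGK nsFG) -(quotientGK (normalS sFM sMG nsFG)).
  by rewrite cosetpre_normal defM pcore_normal.
have nilGM : nilpotent (G / M).
  apply: nilpotent_quotient_trivg_pcore2 => //; apply/eqP.
  rewrite -(isog_eq1 (isog_pcore 2 (third_isog sFM nsFG nsMG))) /= defM.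
  by rewrite trivg_pcore_quotient.
split=> //; exists (fuse_solvable fuseG).
rewrite /fitting_length; case: ex_minnP => m _; apply.
apply/existsP; exists [tuple 'F(G)%G; M; G].
rewrite /nilpotent_normal_series /= eqxx !andbT.
rewrite /nilpotent_factor sub1G sFM sMG nsFG nsMG normal_refl nilGM /=.
rewrite quotient_nil ?Fitting_nil //= defM andbT.
exact: pgroup_nil (pcore_pgroup 2 _).
Qed.
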